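(* Assume that the unit cell is mirror symmetric, i.e. $\varepsilon(x,\omega)=\varepsilon(1-x,\omega)$ for $x\in[0,1]$, and that the $n$-th eigenvalue of the operator $\mathcal{L}$ is non-degenerate. Then the Zak phase $\Theta_n$ satisfies $\Theta_n \ \mathrm{mod}\ (2\pi)\in\{0,\pi\}$.
   Context: Setting. $\mu_0>0$ is a constant; $\varepsilon(x,\omega)$ is a real-valued permittivity, $1$-periodic in $x$, equal to $\varepsilon_1(\omega)$ or $\varepsilon_2(\omega)$ (continuous functions of $\omega$) on the successive intervals of a finite partition of the unit cell $[0,1]$. The operator is $\mathcal{L}u=-\frac{1}{\mu_0}\frac{d}{dx}\left(\frac{1}{\varepsilon(x,\omega)}\frac{du}{dx}\right)$. For $\kappa\in\mathcal{B}=[-\pi,\pi]$, the Bloch modes are the non-zero solutions of $\mathcal{L}u=\omega^2u$ with $u(x+1)=e^{i\kappa}u(x)$ and $u'(x+1)=e^{i\kappa}u'(x)$; they lie in $L^2_\kappa=\{f\in L^2_{\mathrm{loc}}: f(x+1)=e^{i\kappa}f(x)\}$. The $n$-th band is $\omega=\omega_n(\kappa)$ with $\omega_n(-\kappa)=\omega_n(\kappa)$; the $n$-th eigenvalue is $\lambda_n=\omega_n(\kappa)^2$ and $u_n^{[\kappa]}$ is the corresponding Bloch mode. Non-degenerate means that for each $\kappa$ the space of Bloch modes at $\omega_n(\kappa)$ with quasiperiodicity $\kappa$ is one-dimensional. Inner product: $\langle f,g\rangle=\int_0^1\mu_0 f(x)\overline{g(x)}\,dx$. The modes are normalised, $\|u_n^{[\kappa]}\|=1$,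 chosen to depend smoothly on $\kappa\in[-\pi,\pi]$, with $u_n^{[-\pi]}=u_n^{[\pi]}$ (the remaining freedom being phase changes such as $u_n^{[\kappa]}\mapsto e^{i\zeta\kappa}u_n^{[\kappa]}$ with $\zeta$ an integer, which change $\Theta_n$ only by multiples of $2\pi$). Berry connection of the $n$-th band: $A_n(\kappa):=-i\left\langle\frac{\partial u_n^{[\kappa]}}{\partial\kappa},u_n^{[\kappa]}\right\rangle$. Zak phase: $\Theta_n:=\int_{-\pi}^{\pi}A_n(\kappa)\,d\kappa$. *)

(* Defs.v *)
From Stdlib Require Import Reals.
From Coquelicot Require Import Coquelicot.

Open Scope R_scope.

Definition BZ (k : R) : Prop := - PI <= k <= PI.

(* e^{i t} *)
Definition cis (t : R) : C := (cos t, sin t).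

(* [eps x w] is the permittivity at position x and frequency w.  Its values at
   the finitely many break points of the partition are left free, so that the
   intervals may be taken open, half-open or closed. *)
Definition layered_permittivity (eps1 eps2 : R -> R) (eps : R -> R -> R) : Prop :=
  (forall w, continuous eps1 w) /\
  (forall w, continuous eps2 w) /\
  (forall x w, eps (x + 1) w = eps x w) /\
  exists (N : nat) (xs : nat -> R) (s : nat -> bool),
    xs 0%nat = 0 /\ xs N = 1 /\
    (forall j, (j < N)%nat -> xs j < xs (S j)) /\
    (forall j, (j < N)%nat -> forall x w, xs j < x < xs (S j) ->
       eps x w = if s j then eps1 w else eps2 w).

Definition mirror_symmetric (eps : R -> R -> R) : Prop :=
  forall x w, 0 <= x <= 1 -> eps x w = eps (1 - x) w.

(* x is not on an interface of the material with permittivity profile e. *)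
Definition homogeneous_at (e : R -> R) (x : R) : Prop :=
  locally x (fun y => e y = e x).

(* L f = lam f for L = -(1/mu0) d/dx ((1/e) d/dx): the coefficient 1/e jumps at
   the interfaces, so f and the flux p = (1/e) f' are required to be continuous
   on the whole line and the differential equation to hold off the interfaces.
   The clause [e x <> 0] says that 1/e, hence L, is defined. *)
Definition eigen_eq (mu0 : R) (e : R -> R) (lam : R) (f : R -> C) : Prop :=
  exists f' p p' : R -> C,
    (forall x, @continuous R_UniformSpace C_R_NormedModule f x) /\
    (forall x, @continuous R_UniformSpace C_R_NormedModule p x) /\
    forall x, homogeneous_at e x ->
      e x <> 0 /\
      @is_derive R_AbsRing C_R_NormedModule f x (f' x) /\
      p x = (RtoC (1 / e x) * f' x)%C /\
      @is_derive R_AbsRing C_R_NormedModule p x (p' x) /\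
      (- (RtoC (1 / mu0) * p' x))%C = (RtoC lam * f x)%C.

Definition quasiperiodic (k : R) (f : R -> C) : Prop :=
  (forall x, f (x + 1) = (cis k * f x)%C) /\
  (forall x l, @is_derive R_AbsRing C_R_NormedModule f x l ->
     @is_derive R_AbsRing C_R_NormedModule f (x + 1) (cis k * l)%C).

(* The space of Bloch modes at frequency w, zero function included. *)
Definition bloch_space (mu0 : R) (eps : R -> R -> R) (w k : R) (f : R -> C) : Prop :=
  eigen_eq mu0 (fun x => eps x w) (w ^ 2) f /\ quasiperiodic k f.

Definition bloch_mode (mu0 : R) (eps : R -> R -> R) (w k : R) (f : R -> C) : Prop :=
  bloch_space mu0 eps w k f /\ exists x, f x <> RtoC 0.

(* For every k the Bloch space at frequency [omega k] is one-dimensional. *)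
Definition nondegenerate (mu0 : R) (eps : R -> R -> R) (omega : R -> R) : Prop :=
  forall k, BZ k ->
    exists f, bloch_mode mu0 eps (omega k) k f /\
      forall g, bloch_space mu0 eps (omega k) k g ->
        exists c : C, forall x, g x = (c * f x)%C.

Definition inner (mu0 : R) (f g : R -> C) : C :=
  @RInt C_R_CompleteNormedModule (fun x => RtoC mu0 * f x * Cconj (g x))%C 0 1.

Definition norm_cell (mu0 : R) (f : R -> C) : R := sqrt (Re (inner mu0 f f)).

Definition cell_rect (z : R * R) : Prop := BZ (fst z) /\ 0 <= snd z <= 1.

(* u is C^infinity in k on the closed interval [-pi, pi], as a family of
   functions of x on the unit cell: [v j] is the j-th k-derivative of u in the
   interior, and extends continuously to [-pi, pi] x [0, 1]. *)
Definition smooth_in_kappa (u : R -> R -> C) : Prop :=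
  exists v : nat -> R -> R -> C,
    (forall k x, BZ k -> 0 <= x <= 1 -> v 0%nat k x = u k x) /\
    (forall j k x, - PI < k < PI -> 0 <= x <= 1 ->
       @is_derive R_AbsRing C_R_NormedModule (fun t => v j t x) k (v (S j) k x)) /\
    (forall j (z : R * R), cell_rect z ->
       filterlim (fun y : R * R => v j (fst y) (snd y))
         (within cell_rect (locally z))
         (@locally C_R_NormedModule (v j (fst z) (snd z)))).

(* Two-sided derivative, hence meaningful for -pi < k < pi only when u is
   prescribed on [-pi, pi]; the end points do not affect [zak_phase]. *)
Definition dkappa (u : R -> R -> C) (k : R) : R -> C :=
  fun x => (Derive (fun t => Re (u t x)) k, Derive (fun t => Im (u t x)) k).

Definition berry_connection (mu0 : R) (u : R -> R -> C) (k : R) : C :=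
  (- Ci * inner mu0 (dkappa u k) (u k))%C.

Definition zak_phase (mu0 : R) (u : R -> R -> C) : C :=
  @RInt C_R_CompleteNormedModule (berry_connection mu0 u) (- PI) PI.

(* z mod 2 pi is the (real) class of r. *)
Definition eq_mod_2pi (z : C) (r : R) : Prop :=
  exists m : Z, z = RtoC (r + 2 * PI * IZR m).

(* Main.v *)
Require Import Defs.
From Stdlib Require Import Reals ZArith Lra Lia.
From Coquelicot Require Import Coquelicot.
Open Scope R_scope.

(** Mirror symmetry sends a Bloch mode at quasimomentum [-k] to one at [k]: with
    u_k the given modes, the function x |-> u_{-k}(1 - x) solves the same equation
    as u_k with the same quasiperiodicity ([eigen_eq_reflect],
    [quasiperiodic_reflect]).  Non-degeneracy gives a scalar c(k) with
      u_{-k}(1 - x) = c(k) u_k(x)                            (1)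
    ([mirror_mode]).  Normalisation gives |c(k)| = 1.  At k = 0, and at k = PI
    because u_{-PI} = u_{PI}, relation (1) equates the reflection of a single
    function with a multiple of it; reflecting twice yields c(0)^2 = c(PI)^2 = 1
    ([mirror_factor_fixed]).

    Let B(k) be the inner product of the k-derivative of u_k with u_k, so that the
    Berry connection is A = - i B.  Differentiating (1) in k and pairing with (1)
    gives B(k) + B(-k) = - c'(k) conj(c(k)).  Since |c| = 1 the right-hand side is
    purely imaginary, so s(k) = A(k) + A(-k) is real and c' = - i s c: the unit
    vector c rotates with angular speed - s ([unit_rotation]).  The Zak phase is
    the integral of s over [0, PI] ([RInt_fold]), which is minus the angle swept
    by c between two points of {1, -1}, hence a multiple of PI ([rotation_angle]).

    Two analytic points are needed.  Near a given k, the function c is the quotient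
    of the two sides of (1) at one x where u_k(x) does not vanish, so it is
    differentiable without differentiating under an integral sign
    ([ex_derive_quotient]).  The modes and their k-derivatives are only controlled
    on the rectangle [-PI, PI] x [0, 1]; composing with the nearest-point maps
    extends them to jointly continuous functions on the plane
    ([clamp_extend_continuous]), and all inner products then depend continuously
    on k ([C_continuous_inner_param]). *)

(** * Complex-valued integrals *)

(** [ring] on an equation between complex numbers stated in a normed module. *)
Ltac C_ring := match goal with |- ?a = ?b => change (@eq C a b); ring end.

(** Continuity on the whole line, componentwise. *)
Definition C_continuous (f : R -> C) : Prop :=
  forall x, continuous (fun y => Re (f y)) x /\ continuous (fun y => Im (f y)) x.

Lemma C_continuous_plus f g :
  C_continuous f -> C_continuous g ->
  C_continuous (fun x => (f x + g x)%C).
Proof.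
  intros Hf Hg x; destruct (Hf x), (Hg x).
  split; apply (continuous_plus (V := R_NormedModule)); assumption.
Qed.

Lemma C_continuous_mult f g :
  C_continuous f -> C_continuous g ->
  C_continuous (fun x => (f x * g x)%C).
Proof.
  intros Hf Hg x; destruct (Hf x), (Hg x); split.
  - apply (continuous_minus (V := R_NormedModule));
      apply (continuous_mult (K := R_AbsRing)); assumption.
  - apply (continuous_plus (V := R_NormedModule));
      apply (continuous_mult (K := R_AbsRing)); assumption.
Qed.

Lemma C_continuous_const c : C_continuous (fun _ => c).
Proof. intros x; split; apply continuous_const. Qed.

Lemma C_continuous_scal c f :
  C_continuous f -> C_continuous (fun x => (c * f x)%C).
Proof. apply C_continuous_mult, C_continuous_const. Qed.

Lemma C_continuous_conj f :
  C_continuous f -> C_continuous (fun x => Cconj (f x)).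
Proof.
  intros Hf x; destruct (Hf x); split; [assumption|].
  apply (continuous_opp (V := R_NormedModule)); assumption.
Qed.

Lemma C_continuous_reflect f :
  C_continuous f -> C_continuous (fun x => f (1 - x)).
Proof.
  intros Hf x.
  assert (H1 : continuous (fun y : R => 1 - y) x).
  { apply (continuous_minus (V := R_NormedModule));
      [apply continuous_const | apply continuous_id]. }
  destruct (Hf (1 - x)); split.
  - apply (continuous_comp (fun y => 1 - y) (fun y => Re (f y))); assumption.
  - apply (continuous_comp (fun y => 1 - y) (fun y => Im (f y))); assumption.
Qed.

Lemma ex_RInt_C f a b :
  C_continuous f ->
  ex_RInt (fun x => Re (f x)) a b /\ ex_RInt (fun x => Im (f x)) a b.
Proof.
  intros Hf; split; apply (ex_RInt_continuous (V := R_CompleteNormedModule));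
    intros x _; apply Hf.
Qed.

(** Integration of a complex-valued function is componentwise. *)
Lemma RInt_C_components (f : R -> C) a b :
  ex_RInt (fun x => Re (f x)) a b -> ex_RInt (fun x => Im (f x)) a b ->
  @RInt C_R_CompleteNormedModule f a b =
  (RInt (fun x => Re (f x)) a b, RInt (fun x => Im (f x)) a b).
Proof.
  intros H1 H2.
  apply (is_RInt_unique (V := C_R_CompleteNormedModule)).
  apply (is_RInt_fct_extend_pair (U := R_NormedModule) (V := R_NormedModule)).
  - apply (RInt_correct (V := R_CompleteNormedModule)); exact H1.
  - apply (RInt_correct (V := R_CompleteNormedModule)); exact H2.
Qed.

Lemma RInt_C f a b :
  C_continuous f ->
  @RInt C_R_CompleteNormedModule f a b =
  (RInt (fun x => Re (f x)) a b, RInt (fun x => Im (f x)) a b).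
Proof. intros Hf; apply RInt_C_components; apply (ex_RInt_C f a b Hf). Qed.

Lemma RInt_C_plus f g a b :
  C_continuous f -> C_continuous g ->
  @RInt C_R_CompleteNormedModule (fun x => (f x + g x)%C) a b =
  (@RInt C_R_CompleteNormedModule f a b + @RInt C_R_CompleteNormedModule g a b)%C.
Proof.
  intros Hf Hg; rewrite !RInt_C; try assumption.
  - destruct (ex_RInt_C f a b Hf), (ex_RInt_C g a b Hg).
    apply injective_projections; simpl;
      apply (RInt_plus (V := R_CompleteNormedModule)); assumption.
  - now apply C_continuous_plus.
Qed.

Lemma RInt_C_scal c f a b :
  C_continuous f ->
  @RInt C_R_CompleteNormedModule (fun x => (c * f x)%C) a b =
  (c * @RInt C_R_CompleteNormedModule f a b)%C.
Proof.
  intros Hf; rewrite !RInt_C; try assumption.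
  - destruct (ex_RInt_C f a b Hf) as [H1 H2].
    apply injective_projections; simpl;
      apply (is_RInt_unique (V := R_CompleteNormedModule)).
    + apply (is_RInt_minus (V := R_NormedModule));
        apply (is_RInt_scal (V := R_NormedModule));
        apply (RInt_correct (V := R_CompleteNormedModule)); assumption.
    + apply (is_RInt_plus (V := R_NormedModule));
        apply (is_RInt_scal (V := R_NormedModule));
        apply (RInt_correct (V := R_CompleteNormedModule)); assumption.
  - now apply C_continuous_scal.
Qed.

Lemma RInt_reflect (f : R -> R) :
  (forall x, continuous f x) -> RInt (fun x => f (1 - x)) 0 1 = RInt f 0 1.
Proof.
  intros Hf.
  assert (H : is_RInt (fun y => scal (-1) (f (-1 * y + 1))) 0 1 (RInt f 1 0)).
  { apply (is_RInt_comp_lin (V := R_NormedModule)).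
    replace (-1 * 0 + 1) with 1 by ring. replace (-1 * 1 + 1) with 0 by ring.
    apply (RInt_correct (V := R_CompleteNormedModule)).
    apply (ex_RInt_continuous (V := R_CompleteNormedModule)); intros; apply Hf. }
  apply (is_RInt_scal (V := R_NormedModule)) with (k := -1) in H.
  apply (is_RInt_unique (V := R_CompleteNormedModule)).
  rewrite <- (opp_RInt_swap (V := R_CompleteNormedModule)) in H.
  - unfold scal, opp in H; simpl in H; unfold mult in H; simpl in H.
    replace (RInt f 0 1) with (-1 * - RInt f 0 1) by ring.
    revert H; apply (is_RInt_ext (V := R_NormedModule)).
    intros x _. replace (1 - x) with (-1 * x + 1) by ring.
    change (-1 * (-1 * f (-1 * x + 1)) = f (-1 * x + 1)). ring.
  - apply (ex_RInt_continuous (V := R_CompleteNormedModule)); intros; apply Hf.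
Qed.

(** * The inner product of the unit cell *)

Lemma C_continuous_inner mu f g :
  C_continuous f -> C_continuous g ->
  C_continuous (fun x => (RtoC mu * f x * Cconj (g x))%C).
Proof.
  intros Hf Hg.
  apply C_continuous_mult; [apply C_continuous_mult|].
  - apply C_continuous_const.
  - assumption.
  - now apply C_continuous_conj.
Qed.

Lemma inner_ext mu f1 f2 g1 g2 :
  (forall x, 0 < x < 1 -> f1 x = f2 x) -> (forall x, 0 < x < 1 -> g1 x = g2 x) ->
  inner mu f1 g1 = inner mu f2 g2.
Proof.
  intros Hf Hg; unfold inner; apply (RInt_ext (V := C_R_CompleteNormedModule)).
  rewrite Rmin_left, Rmax_right by lra.
  intros x Hx; now rewrite Hf, Hg.
Qed.

Lemma inner_plus_l mu f1 f2 g :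
  C_continuous f1 -> C_continuous f2 -> C_continuous g ->
  inner mu (fun x => (f1 x + f2 x)%C) g = (inner mu f1 g + inner mu f2 g)%C.
Proof.
  intros H1 H2 Hg; unfold inner.
  rewrite <- RInt_C_plus by now apply C_continuous_inner.
  apply (RInt_ext (V := C_R_CompleteNormedModule)); intros x _; C_ring.
Qed.

Lemma inner_scal_l mu c f g :
  C_continuous f -> C_continuous g ->
  inner mu (fun x => (c * f x)%C) g = (c * inner mu f g)%C.
Proof.
  intros Hf Hg; unfold inner.
  rewrite <- RInt_C_scal by now apply C_continuous_inner.
  apply (RInt_ext (V := C_R_CompleteNormedModule)); intros x _; C_ring.
Qed.

Lemma inner_scal_r mu c f g :
  C_continuous f -> C_continuous g ->
  inner mu f (fun x => (c * g x)%C) = (Cconj c * inner mu f g)%C.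
Proof.
  intros Hf Hg; unfold inner.
  rewrite <- RInt_C_scal by now apply C_continuous_inner.
  apply (RInt_ext (V := C_R_CompleteNormedModule)); intros x _.
  rewrite Cmult_conj; C_ring.
Qed.

Lemma inner_reflect mu f g :
  C_continuous f -> C_continuous g ->
  inner mu (fun x => f (1 - x)) (fun x => g (1 - x)) = inner mu f g.
Proof.
  intros Hf Hg; unfold inner.
  pose proof (C_continuous_inner mu f g Hf Hg) as H.
  rewrite (RInt_C _ _ _ H).
  rewrite (RInt_C _ _ _ (C_continuous_reflect _ H)).
  rewrite <- (RInt_reflect (fun x => Re (RtoC mu * f x * Cconj (g x))%C)) by apply H.
  rewrite <- (RInt_reflect (fun x => Im (RtoC mu * f x * Cconj (g x))%C)) by apply H.
  reflexivity.
Qed.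

Lemma inner_self_Im mu f : C_continuous f -> Im (inner mu f f) = 0.
Proof.
  intros Hf; unfold inner; rewrite RInt_C by now apply C_continuous_inner.
  simpl. rewrite (RInt_ext (V := R_CompleteNormedModule) _ (fun _ => 0)).
  - rewrite (RInt_const (V := R_CompleteNormedModule)).
    unfold scal; simpl; unfold mult; simpl; ring.
  - intros x _. simpl. ring.
Qed.

Lemma inner_self_unit mu f :
  C_continuous f -> norm_cell mu f = 1 -> inner mu f f = RtoC 1.
Proof.
  intros Hf H. apply injective_projections; simpl.
  - unfold norm_cell in H.
    (* sqrt is 0 on negative reals, so the square root being 1 excludes them. *)
    destruct (Rle_dec 0 (Re (inner mu f f))) as [Hp|Hp].
    + change (Re (inner mu f f) = 1).
      rewrite <- (sqrt_sqrt _ Hp), H. ring.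
    + rewrite sqrt_neg_0 in H; lra.
  - now apply inner_self_Im.
Qed.

Lemma unit_inner_neq0 mu f :
  inner mu f f = RtoC 1 -> exists x, 0 <= x <= 1 /\ f x <> RtoC 0.
Proof.
  intros H; apply Classical_Prop.NNPP; intros Hn.
  assert (H0 : inner mu f f = inner mu (fun _ => RtoC 0) (fun _ => RtoC 0)).
  { apply inner_ext; intros x Hx; apply Classical_Prop.NNPP; intros Hc;
      apply Hn; exists x; split; auto; lra. }
  rewrite H in H0.
  apply (f_equal Re) in H0.
  unfold inner in H0; rewrite RInt_C in H0.
  - simpl in H0; rewrite (RInt_ext (V := R_CompleteNormedModule) _ (fun _ => 0)) in H0.
    + rewrite (RInt_const (V := R_CompleteNormedModule)) in H0.
      unfold scal in H0; simpl in H0; unfold mult in H0; simpl in H0; lra.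
    + intros; simpl; ring.
  - apply C_continuous_inner; apply C_continuous_const.
Qed.

(** * Continuous dependence on the quasimomentum *)

(** Joint continuity on the whole plane, componentwise. *)
Definition jointly_continuous (W : R -> R -> C) : Prop :=
  forall k x, continuity_2d_pt (fun s y => Re (W s y)) k x /\
              continuity_2d_pt (fun s y => Im (W s y)) k x.

Lemma continuity_2d_slice_r (h : R -> R -> R) k x :
  continuity_2d_pt h k x -> continuous (fun y => h k y) x.
Proof.
  intros H; apply continuity_pt_filterlim.
  intros e He. destruct (H (mkposreal e He)) as [d Hd].
  exists d; split; [apply cond_pos|].
  intros y [_ Hy]. apply Hd; [|exact Hy].
  rewrite Rminus_diag, Rabs_R0. apply cond_pos.
Qed.

Lemma jointly_continuous_slice W k :
  jointly_continuous W -> C_continuous (W k).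
Proof.
  intros H x; split.
  - apply (continuity_2d_slice_r (fun s y => Re (W s y))), H.
  - apply (continuity_2d_slice_r (fun s y => Im (W s y))), H.
Qed.

Lemma jointly_continuous_inner_integrand mu F G :
  jointly_continuous F -> jointly_continuous G ->
  jointly_continuous (fun k x => (RtoC mu * F k x * Cconj (G k x))%C).
Proof.
  intros HF HG k x. destruct (HF k x) as [F1 F2], (HG k x) as [G1 G2]. split.
  - apply continuity_2d_pt_ext with (fun s y =>
      mu * (Re (F s y) * Re (G s y) + Im (F s y) * Im (G s y))).
    { intros; simpl; unfold Re, Im; ring. }
    apply continuity_2d_pt_mult; [apply continuity_2d_pt_const|].
    apply continuity_2d_pt_plus; apply continuity_2d_pt_mult; assumption.
  - apply continuity_2d_pt_ext with (fun s y =>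
      mu * (Im (F s y) * Re (G s y) - Re (F s y) * Im (G s y))).
    { intros; simpl; unfold Re, Im; ring. }
    apply continuity_2d_pt_mult; [apply continuity_2d_pt_const|].
    apply continuity_2d_pt_minus; apply continuity_2d_pt_mult; assumption.
Qed.

Lemma continuous_RInt_param (h : R -> R -> R) a b :
  a <= b -> (forall k x, continuity_2d_pt h k x) ->
  forall k, continuous (fun s => RInt (h s) a b) k.
Proof.
  intros Hab Hh k.
  assert (Hex : forall s, ex_RInt (h s) a b).
  { intros s; apply (ex_RInt_continuous (V := R_CompleteNormedModule)).
    intros x _; apply (continuity_2d_slice_r h), Hh. }
  apply continuity_pt_filterlim; intros e He.
  assert (He' : 0 < e / (b - a + 1)) by (apply Rdiv_lt_0_compat; lra).
  destruct (uniform_continuity_2d_1d' h a b k (fun x _ => Hh k x)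
              (mkposreal _ He')) as [d Hd].
  exists d; split; [apply cond_pos|].
  intros s [_ Hs]; simpl in Hs |- *; unfold R_dist in *.
  rewrite <- (RInt_minus (V := R_CompleteNormedModule)) by apply Hex.
  apply Rle_lt_trans with ((b - a) * (e / (b - a + 1))).
  - apply abs_RInt_le_const; [exact Hab | |].
    + apply (ex_RInt_minus (V := R_NormedModule)); apply Hex.
    + intros x Hx. apply Rlt_le, Hd; try assumption.
      * pose proof (cond_pos d); lra.
      * apply Rabs_def2 in Hs; lra.
      * rewrite Rminus_diag, Rabs_R0; apply cond_pos.
  - apply Rlt_le_trans with ((b - a + 1) * (e / (b - a + 1))).
    + apply Rmult_lt_compat_r; lra.
    + right; field; lra.
Qed.

Lemma C_continuous_inner_param mu F G :
  jointly_continuous F -> jointly_continuous G ->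
  C_continuous (fun k => inner mu (F k) (G k)).
Proof.
  intros HF HG k.
  pose proof (jointly_continuous_inner_integrand mu F G HF HG) as H.
  assert (E : forall s, inner mu (F s) (G s) =
    (RInt (fun x => Re (RtoC mu * F s x * Cconj (G s x))%C) 0 1,
     RInt (fun x => Im (RtoC mu * F s x * Cconj (G s x))%C) 0 1)).
  { intros s; apply RInt_C.
    apply (jointly_continuous_slice _ s H). }
  split.
  - apply (continuous_ext (fun s => RInt (fun x =>
      Re (RtoC mu * F s x * Cconj (G s x))%C) 0 1)).
    { intros s; now rewrite E. }
    apply continuous_RInt_param; [lra | intros; apply H].
  - apply (continuous_ext (fun s => RInt (fun x =>
      Im (RtoC mu * F s x * Cconj (G s x))%C) 0 1)).
    { intros s; now rewrite E. }
    apply continuous_RInt_param; [lra | intros; apply H].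
Qed.

(** The point of the interval from [a] to [b] nearest to [x], for [a <= b]. *)
Definition clamp (a b x : R) : R := Rmax a (Rmin b x).

Lemma clamp_in a b x : a <= b -> a <= clamp a b x <= b.
Proof.
  intros H; unfold clamp; split; [apply Rmax_l|].
  apply Rmax_lub; [exact H | apply Rmin_l].
Qed.

Lemma clamp_id a b x : a <= x <= b -> clamp a b x = x.
Proof. intros H; unfold clamp; rewrite Rmin_right, Rmax_right; lra. Qed.

Lemma clamp_lipschitz a b x y : Rabs (clamp a b y - clamp a b x) <= Rabs (y - x).
Proof.
  unfold clamp, Rmax, Rmin.
  repeat destruct Rle_dec; unfold Rabs; repeat destruct Rcase_abs; lra.
Qed.

(** Extension to the plane of a family given for [k] in [BZ] and [x] in the cell. *)
Definition clamp_extend (w : R -> R -> C) (k x : R) : C :=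
  w (clamp (- PI) PI k) (clamp 0 1 x).

Lemma clamp_extend_id w k x : BZ k -> 0 <= x <= 1 -> clamp_extend w k x = w k x.
Proof. intros Hk Hx; unfold clamp_extend; now rewrite !clamp_id. Qed.

Lemma clamp_extend_continuous (w : R -> R -> C) :
  (forall z : R * R, cell_rect z ->
     filterlim (fun y : R * R => w (fst y) (snd y))
       (within cell_rect (locally z))
       (@locally C_R_NormedModule (w (fst z) (snd z)))) ->
  jointly_continuous (clamp_extend w).
Proof.
  intros H k x.
  assert (HP := PI_RGT_0).
  assert (Hr : forall s y, cell_rect (clamp (- PI) PI s, clamp 0 1 y)).
  { intros s y; split; apply clamp_in; lra. }
  specialize (H _ (Hr k x)); simpl in H.
  assert (B : forall e : posreal, locally_2d (fun s y =>
     Rabs (Re (clamp_extend w s y) - Re (clamp_extend w k x)) < e /\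
     Rabs (Im (clamp_extend w s y) - Im (clamp_extend w k x)) < e) k x).
  { intros e.
    destruct (H (fun c : C => @ball C_R_NormedModule
       (w (clamp (- PI) PI k) (clamp 0 1 x)) e c)) as [d Hd].
    { exists e; auto. }
    exists d; intros s y Hs Hy.
    apply (Hd (clamp (- PI) PI s, clamp 0 1 y)); [|apply Hr].
    split; simpl; (eapply Rle_lt_trans; [apply clamp_lipschitz|]); assumption. }
  split; intros e; apply locally_2d_impl with (2 := B e);
    apply locally_2d_forall; intros s y [H1 H2]; assumption.
Qed.

(** * Differentiability of a complex quotient *)

Lemma Cmod2_neq0 (f : C) : f <> RtoC 0 -> Re f * Re f + Im f * Im f <> 0.
Proof.
  intros Hf E; apply Hf; apply injective_projections; simpl; unfold Re, Im in *; nra.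
Qed.

Lemma Cquot_Re_Im (c f h : C) :
  h = (c * f)%C -> f <> RtoC 0 ->
  Re c = (Re h * Re f + Im h * Im f) / (Re f * Re f + Im f * Im f) /\
  Im c = (Im h * Re f - Re h * Im f) / (Re f * Re f + Im f * Im f).
Proof.
  intros -> Hf; apply Cmod2_neq0 in Hf.
  unfold Re, Im in *; simpl; split; field; assumption.
Qed.

Lemma ex_derive_norm2 (f1 f2 : R -> R) k :
  ex_derive f1 k -> ex_derive f2 k -> ex_derive (fun s => f1 s * f1 s + f2 s * f2 s) k.
Proof. intros; auto_derive; tauto. Qed.

Lemma ex_derive_quotient (c f h : R -> C) k0 :
  ex_derive (fun k => Re (f k)) k0 -> ex_derive (fun k => Im (f k)) k0 ->
  ex_derive (fun k => Re (h k)) k0 -> ex_derive (fun k => Im (h k)) k0 ->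
  locally k0 (fun k => h k = (c k * f k)%C) -> f k0 <> RtoC 0 ->
  ex_derive (fun k => Re (c k)) k0 /\ ex_derive (fun k => Im (c k)) k0.
Proof.
  intros F1 F2 H1 H2 E Hf.
  pose proof (ex_derive_norm2 _ _ _ F1 F2) as HN.
  assert (Hl : locally k0 (fun k => f k <> RtoC 0)).
  { apply (ex_derive_continuous (V := R_NormedModule)) in HN.
    specialize (HN (fun y => y <> 0) (open_neq 0 _ (Cmod2_neq0 _ Hf))).
    revert HN; unfold filtermap; apply filter_imp.
    intros k Hk E0; rewrite E0 in Hk; apply Hk; simpl; ring. }
  generalize (filter_and _ _ E Hl); clear E Hl; intros E.
  apply Cmod2_neq0 in Hf.
  split.
  - apply ex_derive_ext_loc with (fun k =>
      (Re (h k) * Re (f k) + Im (h k) * Im (f k)) /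
      (Re (f k) * Re (f k) + Im (f k) * Im (f k))).
    + apply filter_imp with (2 := E); intros k [Ek Hk].
      symmetry; now apply (Cquot_Re_Im _ (f k) (h k)).
    + apply ex_derive_div; try assumption.
      apply (ex_derive_plus (V := R_NormedModule)); apply ex_derive_mult; assumption.
  - apply ex_derive_ext_loc with (fun k =>
      (Im (h k) * Re (f k) - Re (h k) * Im (f k)) /
      (Re (f k) * Re (f k) + Im (f k) * Im (f k))).
    + apply filter_imp with (2 := E); intros k [Ek Hk].
      symmetry; now apply (Cquot_Re_Im _ (f k) (h k)).
    + apply ex_derive_div; try assumption.
      apply (ex_derive_minus (V := R_NormedModule)); apply ex_derive_mult; assumption.
Qed.

(** * Rotating vectors *)

(** The vector [(a, b)] rotates with angular speed [- s] and lies on the real axis,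
    away from the origin, at times [0] and [L]; so it has swept a multiple of [PI]. *)
Lemma rotation_angle (a b s : R -> R) (L : R) :
  0 < L ->
  (forall x, continuous a x) -> (forall x, continuous b x) ->
  (forall x, continuous s x) ->
  (forall x, 0 < x < L -> is_derive a x (s x * b x)) ->
  (forall x, 0 < x < L -> is_derive b x (- (s x * a x))) ->
  a 0 <> 0 -> b 0 = 0 -> a L <> 0 -> b L = 0 ->
  exists m : Z, RInt s 0 L = IZR m * PI.
Proof.
  intros HL Ca Cb Cs Da Db Ha0 Hb0 HaL HbL.
  set (G := fun x => RInt s 0 x).
  assert (DG : forall x, is_derive G x (s x)).
  { intros x; apply (is_derive_RInt (V := R_NormedModule) s G 0 x); [|apply Cs].
    apply filter_forall; intros y; apply (RInt_correct (V := R_CompleteNormedModule)).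
    apply (ex_RInt_continuous (V := R_CompleteNormedModule)); intros; apply Cs. }
  (* F is the imaginary part of (a + i b) exp (i G), which is constant. *)
  set (F := fun x => a x * sin (G x) + b x * cos (G x)).
  assert (DF : forall x, 0 < x < L -> is_derive F x 0).
  { intros x Hx; unfold F.
    pose proof (Da x Hx) as D1. pose proof (Db x Hx) as D2. pose proof (DG x) as D3.
    auto_derive.
    - repeat split; eexists; eassumption.
    - rewrite (is_derive_unique (fun y : R => a y) _ _ D1), (is_derive_unique (fun y : R => b y) _ _ D2),
        (is_derive_unique (fun y : R => G y) _ _ D3); ring. }
  assert (CG : forall x, continuous G x).
  { intros x; apply (ex_derive_continuous (V := R_NormedModule)).
    eexists; apply DG. }
  assert (CF : forall x, continuous F x).
  { intros x; unfold F.
    apply (continuous_plus (V := R_NormedModule));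
      apply (continuous_mult (K := R_AbsRing)); try apply Ca; try apply Cb.
    - apply continuous_comp; [apply CG | apply continuity_pt_filterlim, continuity_sin].
    - apply continuous_comp; [apply CG | apply continuity_pt_filterlim, continuity_cos]. }
  assert (E : F L = F 0).
  { destruct (MVT_gen F 0 L (fun _ => 0)) as [x [_ Hx]].
    - rewrite Rmin_left, Rmax_right by lra. exact DF.
    - intros x _; apply continuity_pt_filterlim, CF.
    - lra. }
  assert (G0 : G 0 = 0) by apply (RInt_point (V := R_CompleteNormedModule)).
  unfold F in E; rewrite G0, sin_0, Hb0, HbL in E.
  assert (HS : sin (G L) = 0) by nra.
  destruct (sin_eq_0_0 _ HS) as [m Hm]. exists m; exact Hm.
Qed.

(** * The Zak phase of a mirror-symmetric family *)

(** Reflecting twice gives [c ^ 2 = 1], whence [c] is real and non-zero. *)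
Lemma mirror_factor_fixed (c : C) (f : R -> C) (x0 : R) :
  (forall x, 0 <= x <= 1 -> f (1 - x) = (c * f x)%C) ->
  0 <= x0 <= 1 -> f x0 <> RtoC 0 -> Re c <> 0 /\ Im c = 0.
Proof.
  intros H Hx0 Hf.
  assert (E : (c * c)%C = RtoC 1).
  { pose proof (H (1 - x0) ltac:(lra)) as E1.
    rewrite (H x0 Hx0) in E1. replace (1 - (1 - x0)) with x0 in E1 by ring.
    rewrite Cmult_assoc in E1.
    replace (c * c)%C with ((c * c * f x0) / f x0)%C by (field; exact Hf).
    rewrite <- E1; field; exact Hf. }
  apply (f_equal fst) in E as E1; apply (f_equal snd) in E as E2; simpl in E1, E2.
  unfold Re, Im; split; nra.
Qed.

Lemma jointly_continuous_mirror V :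
  jointly_continuous V -> jointly_continuous (fun k x => V (- k) (1 - x)).
Proof.
  intros HV k x; destruct (HV (- k) (1 - x)) as [H1 H2].
  split; intros e.
  - destruct (H1 e) as [d Hd]; exists d; intros s y Hs Hy; apply (Hd (- s) (1 - y)).
    + replace (- s - - k) with (- (s - k)) by ring; now rewrite Rabs_Ropp.
    + replace (1 - y - (1 - x)) with (- (y - x)) by ring; now rewrite Rabs_Ropp.
  - destruct (H2 e) as [d Hd]; exists d; intros s y Hs Hy; apply (Hd (- s) (1 - y)).
    + replace (- s - - k) with (- (s - k)) by ring; now rewrite Rabs_Ropp.
    + replace (1 - y - (1 - x)) with (- (y - x)) by ring; now rewrite Rabs_Ropp.
Qed.

Lemma RInt_fold (h : R -> R) (L : R) :
  (forall x, continuous h x) ->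
  RInt h (- L) L = RInt (fun x => h x + h (- x)) 0 L.
Proof.
  intros Hh.
  assert (Hex : forall a b, ex_RInt h a b).
  { intros a b; apply (ex_RInt_continuous (V := R_CompleteNormedModule)); intros; apply Hh. }
  assert (Hr : is_RInt (fun x => h (- x)) 0 L (RInt h (- L) 0)).
  { assert (H : is_RInt h (- 0) (- L) (RInt h 0 (- L))).
    { rewrite Ropp_0; apply (RInt_correct (V := R_CompleteNormedModule)), Hex. }
    apply (is_RInt_comp_opp (V := R_NormedModule)) in H.
    apply (is_RInt_opp (V := R_NormedModule)) in H.
    rewrite (opp_RInt_swap (V := R_CompleteNormedModule)) in H by apply Hex.
    revert H; apply (is_RInt_ext (V := R_NormedModule)).
    intros x _; apply (opp_opp (G := R_AbelianGroup)). }
  symmetry; apply (is_RInt_unique (V := R_CompleteNormedModule)).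
  rewrite <- (RInt_Chasles (V := R_CompleteNormedModule) h (- L) 0 L) by apply Hex.
  rewrite plus_comm.
  apply (is_RInt_plus (V := R_NormedModule)); [|exact Hr].
  apply (RInt_correct (V := R_CompleteNormedModule)), Hex.
Qed.

(** On the unit circle the relation [z = - c' conj c] determines [c']; it is used
    with [z = B k + B (- k)]. *)
Lemma unit_rotation (c c' z : C) :
  Re c * Re c + Im c * Im c = 1 -> Re c' * Re c + Im c' * Im c = 0 ->
  z = (- (c' * Cconj c))%C ->
  Re z = 0 /\ Re c' = Im z * Im c /\ Im c' = - (Im z * Re c).
Proof.
  intros H1 H0 ->; destruct c as [a b], c' as [a' b']; unfold Re, Im in *; simpl in *.
  repeat split.
  - lra.
  - transitivity (a' * (a * a + b * b) - a * (a' * a + b' * b)); [rewrite H1, H0 |]; ring.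
  - transitivity (b' * (a * a + b * b) - b * (a' * a + b' * b)); [rewrite H1, H0 |]; ring.
Qed.

Lemma Cmult_conj_unit (c : C) :
  (c * Cconj c)%C = RtoC 1 -> Re c * Re c + Im c * Im c = 1.
Proof.
  intros H; apply (f_equal fst) in H; destruct c; unfold Re, Im; simpl in *; lra.
Qed.

(** The Berry phase of a normalised mirror-symmetric family is a multiple of [PI];
    [V1] is the derivative of [V0] in [k] in the interior of [BZ]. *)
Lemma berry_phase_multiple_PI (mu : R) (V0 V1 : R -> R -> C) :
  jointly_continuous V0 -> jointly_continuous V1 ->
  (forall k x, - PI < k < PI -> 0 <= x <= 1 ->
     is_derive (fun t => Re (V0 t x)) k (Re (V1 k x)) /\
     is_derive (fun t => Im (V0 t x)) k (Im (V1 k x))) ->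
  (forall k, BZ k -> inner mu (V0 k) (V0 k) = RtoC 1) ->
  (forall k, BZ k -> exists c : C, forall x, 0 <= x <= 1 ->
     V0 (- k) (1 - x) = (c * V0 k x)%C) ->
  (forall x, 0 <= x <= 1 -> V0 (- PI) x = V0 PI x) ->
  exists m : Z,
    @RInt C_R_CompleteNormedModule
      (fun k => (- Ci * inner mu (V1 k) (V0 k))%C) (- PI) PI = RtoC (IZR m * PI).
Proof.
  intros J0 J1 D N M Pe.
  assert (HP := PI_RGT_0).
  set (W := fun k x => V0 (- k) (1 - x)).
  assert (JW : jointly_continuous W) by now apply jointly_continuous_mirror.
  assert (C0 : forall k, C_continuous (V0 k)) by (intros; now apply jointly_continuous_slice).
  assert (C1 : forall k, C_continuous (V1 k)) by (intros; now apply jointly_continuous_slice).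
  assert (CW : forall k, C_continuous (W k)) by (intros; now apply jointly_continuous_slice).
  set (c := fun k => inner mu (W k) (V0 k)).
  assert (Cc : C_continuous c) by exact (C_continuous_inner_param mu W V0 JW J0).
  assert (Hc : forall k x, BZ k -> 0 <= x <= 1 -> W k x = (c k * V0 k x)%C).
  { intros k x Hk Hx; destruct (M k Hk) as [c0 H0].
    replace (c k) with c0; [now apply H0|].
    unfold c; rewrite (inner_ext mu (W k) (fun y => (c0 * V0 k y)%C) (V0 k) (V0 k)).
    - rewrite inner_scal_l, N by auto; ring.
    - intros y Hy; apply H0; lra.
    - reflexivity. }
  assert (Hmod : forall k, BZ k -> (c k * Cconj (c k))%C = RtoC 1).
  { intros k Hk.
    assert (Hk' : BZ (- k)) by (unfold BZ in *; lra).
    rewrite <- (N _ Hk'), <- (inner_reflect mu (V0 (- k)) (V0 (- k))) by auto.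
    change (fun x => V0 (- k) (1 - x)) with (W k).
    rewrite (inner_ext mu (W k) (fun y => (c k * V0 k y)%C) (W k) (fun y => (c k * V0 k y)%C))
      by (intros y Hy; apply Hc; [exact Hk | lra]).
    rewrite inner_scal_l, inner_scal_r, N; auto; [ring|].
    apply C_continuous_scal, C0. }
  assert (Hfix : forall k, BZ k -> (forall x, 0 <= x <= 1 -> V0 (- k) x = V0 k x) ->
     Re (c k) <> 0 /\ Im (c k) = 0).
  { intros k Hk E.
    destruct (unit_inner_neq0 mu (V0 k) (N k Hk)) as [x0 [Hx0 Hn]].
    apply (mirror_factor_fixed (c k) (V0 k) x0); try assumption.
    intros x Hx; rewrite <- (E (1 - x)) by lra. now apply Hc. }
  set (B := fun k => inner mu (V1 k) (V0 k)).
  assert (CB : C_continuous B) by exact (C_continuous_inner_param mu V1 V0 J1 J0).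
  (* The mirror relation, differentiated in k and paired with itself. *)
  assert (Dc : forall k, - PI < k < PI -> exists c' : C,
     is_derive (fun t => Re (c t)) k (Re c') /\
     is_derive (fun t => Im (c t)) k (Im c') /\
     (B k + B (- k)%R)%C = (- (c' * Cconj (c k)))%C).
  { intros k Hk.
    assert (Hkb : BZ k) by (unfold BZ; lra).
    assert (DW : forall x, 0 <= x <= 1 ->
       is_derive (fun t => Re (W t x)) k (- Re (V1 (- k) (1 - x))) /\
       is_derive (fun t => Im (W t x)) k (- Im (V1 (- k) (1 - x)))).
    { intros x Hx; destruct (D (- k) (1 - x)) as [D1 D2]; try lra.
      assert (Do : is_derive (fun t : R => - t) k (-1)) by (auto_derive; auto; ring).
      split.
      - replace (- Re (V1 (- k) (1 - x))) with (-1 * Re (V1 (- k) (1 - x))) by ring.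
        apply (is_derive_comp (fun t => Re (V0 t (1 - x))) (fun t => - t) k); assumption.
      - replace (- Im (V1 (- k) (1 - x))) with (-1 * Im (V1 (- k) (1 - x))) by ring.
        apply (is_derive_comp (fun t => Im (V0 t (1 - x))) (fun t => - t) k); assumption. }
    assert (Hloc : locally k (fun t => BZ t)).
    { apply (filter_imp (fun t => - PI < t < PI)); [unfold BZ; intros; lra|].
      apply (open_and _ _ (open_gt (- PI)) (open_lt PI)); exact Hk. }
    (* Near k, the factor c is the quotient of W by V0 at this x0. *)
    destruct (unit_inner_neq0 mu (V0 k) (N k Hkb)) as [x0 [Hx0 Hn]].
    destruct (ex_derive_quotient c (fun t => V0 t x0) (fun t => W t x0) k) as [Ea Eb].
    { eexists; exact (proj1 (D k x0 Hk Hx0)). }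
    { eexists; exact (proj2 (D k x0 Hk Hx0)). }
    { eexists; exact (proj1 (DW x0 Hx0)). }
    { eexists; exact (proj2 (DW x0 Hx0)). }
    { apply filter_imp with (2 := Hloc); intros t Ht; now apply Hc. }
    { exact Hn. }
    apply Derive_correct in Ea; apply Derive_correct in Eb.
    exists (Derive (fun t => Re (c t)) k, Derive (fun t => Im (c t)) k).
    set (c' := (Derive (fun t => Re (c t)) k, Derive (fun t => Im (c t)) k) : C).
    split; [exact Ea | split; [exact Eb|]].
    assert (E : forall x, 0 <= x <= 1 ->
       (RtoC (-1) * V1 (- k)%R (1 - x)%R)%C = (c' * V0 k x + c k * V1 k x)%C).
    { intros x Hx; destruct (D k x Hk Hx) as [D1 D2]; destruct (DW x Hx) as [W1 W2].
      assert (P1 : is_derive (fun t => Re (W t x)) k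
        (Re c' * Re (V0 k x) + Re (c k) * Re (V1 k x)
         - (Im c' * Im (V0 k x) + Im (c k) * Im (V1 k x)))).
      { apply is_derive_ext_loc with (fun t => Re (c t) * Re (V0 t x) - Im (c t) * Im (V0 t x)).
        - apply filter_imp with (2 := Hloc); intros t Ht; now rewrite (Hc t x Ht Hx).
        - apply (is_derive_minus (V := R_NormedModule));
            apply (is_derive_mult (fun t => _ (c t))); try assumption; intros; apply Rmult_comm. }
      assert (P2 : is_derive (fun t => Im (W t x)) k
        (Re c' * Im (V0 k x) + Re (c k) * Im (V1 k x)
         + (Im c' * Re (V0 k x) + Im (c k) * Re (V1 k x)))).
      { apply is_derive_ext_loc with (fun t => Re (c t) * Im (V0 t x) + Im (c t) * Re (V0 t x)).
        - apply filter_imp with (2 := Hloc); intros t Ht; now rewrite (Hc t x Ht Hx).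
        - apply (is_derive_plus (V := R_NormedModule));
            apply (is_derive_mult (fun t => _ (c t))); try assumption; intros; apply Rmult_comm. }
      (* DW and the product rule give the same two derivatives. *)
      apply is_derive_unique in W1; apply is_derive_unique in W2.
      apply is_derive_unique in P1; apply is_derive_unique in P2.
      rewrite W1 in P1; rewrite W2 in P2.
      unfold Re, Im in *; apply injective_projections; simpl in *; lra. }
    assert (I1 : inner mu (fun x => (RtoC (-1) * V1 (- k)%R (1 - x)%R)%C) (W k) = (- B (- k)%R)%C).
    { rewrite inner_scal_l by (try apply (C_continuous_reflect (V1 (- k))); auto).
      unfold W, B; rewrite (inner_reflect mu (V1 (- k)) (V0 (- k))) by auto.
      apply injective_projections; simpl; ring. }
    rewrite (inner_ext mu _ (fun x => (c' * V0 k x + c k * V1 k x)%C)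
      (W k) (fun x => (c k * V0 k x)%C)) in I1
      by (intros x Hx; first [apply E | apply Hc]; try assumption; lra).
    pose proof (C_continuous_scal c' _ (C0 k)) as S0.
    pose proof (C_continuous_scal (c k) _ (C1 k)) as S1.
    pose proof (C_continuous_plus _ _ S0 S1) as S2.
    rewrite (inner_scal_r mu (c k) _ (V0 k) S2 (C0 k)) in I1.
    rewrite (inner_plus_l mu _ _ (V0 k) S0 S1 (C0 k)) in I1.
    rewrite (inner_scal_l mu c' (V0 k) (V0 k)), (inner_scal_l mu (c k) (V1 k) (V0 k)),
      (N k Hkb) in I1 by auto.
    fold (B k) in I1.
    replace (B (- k)) with (- (- B (- k)%R))%C by ring. rewrite <- I1.
    replace (Cconj (c k) * (c' * RtoC 1 + c k * B k))%C
      with (Cconj (c k) * c' + (c k * Cconj (c k)) * B k)%C by ring.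
    rewrite (Hmod k Hkb); ring. }
  assert (Drot : forall k, - PI < k < PI ->
     Re (B k) + Re (B (- k)) = 0 /\
     is_derive (fun t => Re (c t)) k ((Im (B k) + Im (B (- k))) * Im (c k)) /\
     is_derive (fun t => Im (c t)) k (- ((Im (B k) + Im (B (- k))) * Re (c k)))).
  { intros k Hk.
    destruct (Dc k Hk) as [c' [Ha [Hb E]]].
    assert (Hkb : BZ k) by (unfold BZ; lra).
    assert (Hm1 : forall t, BZ t -> Re (c t) * Re (c t) + Im (c t) * Im (c t) = 1).
    { intros t Ht; now apply Cmult_conj_unit, Hmod. }
    assert (Hz : Re c' * Re (c k) + Im c' * Im (c k) = 0).
    { assert (Q : is_derive (fun t => Re (c t) * Re (c t) + Im (c t) * Im (c t)) k
        (Re c' * Re (c k) + Re (c k) * Re c' + (Im c' * Im (c k) + Im (c k) * Im c'))).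
      { apply (is_derive_plus (V := R_NormedModule));
          apply (is_derive_mult (fun t => _ (c t))); try assumption; intros; apply Rmult_comm. }
      apply (is_derive_ext_loc _ (fun _ => 1)) in Q.
      - apply is_derive_unique in Q; rewrite Derive_const in Q; lra.
      - apply (filter_imp (fun t => - PI < t < PI)).
        + intros t Ht; apply Hm1; unfold BZ; lra.
        + apply (open_and _ _ (open_gt (- PI)) (open_lt PI)); exact Hk. }
    destruct (unit_rotation (c k) c' (B k + B (- k)%R)%C (Hm1 k Hkb) Hz E)
      as [R1 [R2 R3]].
    split; [exact R1 | split].
    - rewrite R2 in Ha; exact Ha.
    - rewrite R3 in Hb; exact Hb. }
  assert (Cs : forall x, continuous (fun k => Im (B k) + Im (B (- k))) x).
  { intros x; apply (continuous_plus (V := R_NormedModule)); [apply CB|].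
    apply (continuous_comp (fun k => - k) (fun k => Im (B k))); [|apply CB].
    apply (continuous_opp (V := R_NormedModule)), continuous_id. }
  destruct (rotation_angle (fun k => Re (c k)) (fun k => Im (c k))
    (fun k => Im (B k) + Im (B (- k))) PI HP) as [m Hm].
  - exact (fun x => proj1 (Cc x)).
  - exact (fun x => proj2 (Cc x)).
  - exact Cs.
  - intros k Hk; apply (Drot k); lra.
  - intros k Hk; apply (Drot k); lra.
  - apply (Hfix 0); [unfold BZ; lra | intros; now rewrite Ropp_0].
  - apply (Hfix 0); [unfold BZ; lra | intros; now rewrite Ropp_0].
  - apply (Hfix PI); [unfold BZ; lra | exact Pe].
  - apply (Hfix PI); [unfold BZ; lra | exact Pe].
  - exists m.
    change (@RInt C_R_CompleteNormedModule (fun k => (- Ci * B k)%C) (- PI) PI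
            = RtoC (IZR m * PI)).
    rewrite (RInt_C_scal (- Ci) B (- PI) PI CB), (RInt_C B (- PI) PI CB).
    rewrite (RInt_fold (fun k => Im (B k)) PI (fun x => proj2 (CB x))), Hm.
    rewrite (RInt_fold (fun k => Re (B k)) PI (fun x => proj1 (CB x))).
    rewrite (RInt_ext (V := R_CompleteNormedModule) (fun k => Re (B k) + Re (B (- k))) (fun _ => 0)).
    + rewrite (RInt_const (V := R_CompleteNormedModule)).
      apply injective_projections; simpl; unfold scal; simpl; unfold mult; simpl; ring.
    + rewrite Rmin_left, Rmax_right by lra. intros k Hk; apply (Drot k); lra.
Qed.

(** * Reflection of Bloch modes *)

(** By periodicity, the mirror symmetry of the unit cell holds on the whole line. *)
Lemma layered_mirror eps1 eps2 eps :
  layered_permittivity eps1 eps2 eps -> mirror_symmetric eps ->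
  forall x w, eps (1 - x) w = eps x w.
Proof.
  intros [_ [_ [Hp _]]] Hm.
  assert (Hn : forall (n : nat) x w, eps (x + INR n) w = eps x w).
  { induction n as [|n IH]; intros x w.
    - simpl; now rewrite Rplus_0_r.
    - rewrite S_INR, <- Rplus_assoc, Hp; apply IH. }
  assert (Hz : forall (z : Z) x w, eps (x + IZR z) w = eps x w).
  { intros z x w; destruct (Z_le_gt_dec 0 z) as [Hz|Hz].
    - rewrite <- (Z2Nat.id z Hz), <- INR_IZR_INZ; apply Hn.
    - rewrite <- (Hn (Z.to_nat (- z))), INR_IZR_INZ, Z2Nat.id, opp_IZR by lia.
      f_equal; ring. }
  intros x w. pose proof (archimed x) as [A1 A2].
  (* x + (1 - up x) is the fractional part of x. *)
  set (z := up x) in *.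
  replace (1 - x) with ((1 - (x + IZR (1 - z))) + IZR (1 - z)) by ring.
  rewrite Hz, <- Hm by (rewrite minus_IZR; lra).
  apply Hz.
Qed.

Lemma is_derive_reflect (f : R -> C) x l :
  @is_derive R_AbsRing C_R_NormedModule f (1 - x) l ->
  @is_derive R_AbsRing C_R_NormedModule (fun y => f (1 - y)) x (- l)%C.
Proof.
  intros H.
  assert (D : is_derive (fun y : R => 1 - y) x (-1)) by (auto_derive; auto; ring).
  pose proof (is_derive_comp (V := C_R_NormedModule) f (fun y => 1 - y) x l (-1) H D) as E.
  replace (- l)%C with (scal (-1) l : C_R_NormedModule); [exact E|].
  apply injective_projections; simpl; unfold scal; simpl; unfold mult; simpl; ring.
Qed.

Lemma continuous_reflect_C (f : R -> C) x :
  @continuous R_UniformSpace C_R_NormedModule f (1 - x) ->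
  @continuous R_UniformSpace C_R_NormedModule (fun y => f (1 - y)) x.
Proof.
  intros H; apply (continuous_comp (fun y : R => 1 - y) f); [|exact H].
  apply (continuous_minus (V := R_NormedModule));
    [apply continuous_const | apply continuous_id].
Qed.

(** Under reflection [f'] and the flux [p] change sign and [p'] does not. *)
Lemma eigen_eq_reflect mu0 e lam f :
  (forall x, e (1 - x) = e x) -> eigen_eq mu0 e lam f ->
  eigen_eq mu0 e lam (fun x => f (1 - x)).
Proof.
  intros He (f' & p & p' & Cf & Cp & H).
  exists (fun x => (- f' (1 - x)%R)%C), (fun x => (- p (1 - x)%R)%C), (fun x => p' (1 - x)).
  split; [|split].
  - intros x; apply continuous_reflect_C, Cf.
  - intros x; apply (continuous_opp (V := C_R_NormedModule)), continuous_reflect_C, Cp.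
  - intros x Hx.
    assert (Hh : homogeneous_at e (1 - x)).
    { destruct Hx as [d Hd]; exists d; intros y Hy.
      rewrite <- (He y), (He x); apply Hd.
      change (Rabs (y - (1 - x)) < d) in Hy; change (Rabs ((1 - y) - x) < d).
      replace (1 - y - x) with (- (y - (1 - x))) by ring; now rewrite Rabs_Ropp. }
    destruct (H _ Hh) as (H1 & H2 & H3 & H4 & H5).
    rewrite He in H1, H3.
    split; [exact H1|split; [now apply is_derive_reflect|split; [|split; [|exact H5]]]].
    + rewrite H3; ring.
    + replace (p' (1 - x)) with (- - p' (1 - x)%R)%C by ring.
      apply (is_derive_opp (V := C_R_NormedModule) (fun y => p (1 - y))).
      now apply is_derive_reflect.
Qed.

Lemma cis_mult_opp k : (cis k * cis (- k))%C = RtoC 1.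
Proof.
  unfold cis; rewrite cos_neg, sin_neg.
  pose proof (sin2_cos2 k) as H; unfold Rsqr in H.
  apply injective_projections; simpl; lra.
Qed.

Lemma is_derive_linear_comp {U V : NormedModule R_AbsRing} (g : U -> V) (f : R -> U) x l :
  is_linear g -> is_derive f x l -> is_derive (fun y => g (f y)) x (g l).
Proof.
  intros Hg Hf.
  apply (filterdiff_ext_lin _ (fun y : R => g (scal y l))).
  - apply (filterdiff_comp' f g x _ g Hf), filterdiff_linear, Hg.
  - intros y; apply (linear_scal g Hg).
Qed.

Lemma is_linear_R2 (a b : R) :
  is_linear (fun z : prod_NormedModule R_AbsRing R_NormedModule R_NormedModule =>
    a * fst z + b * snd z : R_NormedModule).
Proof.
  apply (is_linear_comp (V := prod_NormedModule R_AbsRing R_NormedModule R_NormedModule)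
    (fun z => (a * fst z, b * snd z)) (fun z => plus (fst z) (snd z)));
    [|apply is_linear_plus].
  apply (is_linear_prod (U := R_NormedModule) (V := R_NormedModule)).
  - apply (is_linear_comp (V := R_NormedModule) (fun z => fst z) (fun t => scal a t));
      [apply is_linear_fst | exact (is_linear_scal_r (K := R_AbsRing) (V := R_NormedModule) a Rmult_comm)].
  - apply (is_linear_comp (V := R_NormedModule) (fun z => snd z) (fun t => scal b t));
      [apply is_linear_snd | exact (is_linear_scal_r (K := R_AbsRing) (V := R_NormedModule) b Rmult_comm)].
Qed.

Lemma is_derive_Re_Im (f : R -> C) x l :
  @is_derive R_AbsRing C_R_NormedModule f x l ->
  is_derive (fun y => Re (f y)) x (Re l) /\ is_derive (fun y => Im (f y)) x (Im l).
Proof.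
  intros H; split.
  - exact (is_derive_linear_comp (U := C_R_NormedModule) (V := R_NormedModule) _ f x l
      is_linear_fst H).
  - exact (is_derive_linear_comp (U := C_R_NormedModule) (V := R_NormedModule) _ f x l
      is_linear_snd H).
Qed.

Lemma is_derive_Cscal (c : C) (f : R -> C) x l :
  @is_derive R_AbsRing C_R_NormedModule f x l ->
  @is_derive R_AbsRing C_R_NormedModule (fun y => (c * f y)%C) x (c * l)%C.
Proof.
  intros H.
  assert (L : is_linear (fun z : C_R_NormedModule => (c * z)%C : C_R_NormedModule)).
  { apply (is_linear_ext (fun z : C_R_NormedModule =>
      (Re c * fst z + - Im c * snd z, Im c * fst z + Re c * snd z) : C_R_NormedModule)).
    - intros z; apply injective_projections; unfold Re, Im; simpl; ring.
    - apply (is_linear_prod (U := R_NormedModule) (V := R_NormedModule)); apply is_linear_R2. }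
  exact (is_derive_linear_comp (U := C_R_NormedModule) (V := C_R_NormedModule) _ f x l L H).
Qed.

Lemma quasiperiodic_reflect k f :
  quasiperiodic (- k) f -> quasiperiodic k (fun x => f (1 - x)).
Proof.
  intros [H _].
  (* This functional equation also implies the clause on derivatives. *)
  assert (E : forall x, f (1 - (x + 1)) = (cis k * f (1 - x)%R)%C).
  { intros x; replace (1 - x) with ((1 - (x + 1)) + 1) by ring.
    rewrite H, Cmult_assoc, cis_mult_opp; ring. }
  split; [exact E|].
  intros x l Hl.
  apply (is_derive_ext (fun y => (cis k * f (1 - (y + -1))%R)%C)).
  { intros y; rewrite <- E; f_equal; ring. }
  apply (is_derive_Cscal (cis k) (fun y => f (1 - (y + -1)))).
  assert (D : is_derive (fun y : R => y + -1) (x + 1) 1) by (auto_derive; auto; ring).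
  replace l with (scal 1 l : C_R_NormedModule) by apply (scal_one (V := C_R_NormedModule)).
  apply (is_derive_comp (V := C_R_NormedModule) (fun y => f (1 - y)) (fun y => y + -1)); [|exact D].
  assert (Ex : @eq R (x + 1 + -1) x) by ring.
  now rewrite Ex.
Qed.

Lemma mirror_mode mu0 eps1 eps2 eps om u :
  layered_permittivity eps1 eps2 eps -> mirror_symmetric eps ->
  nondegenerate mu0 eps om -> (forall k, BZ k -> om (- k) = om k) ->
  (forall k, BZ k -> bloch_mode mu0 eps (om k) k (u k)) ->
  forall k, BZ k -> exists c : C, forall x, u (- k) (1 - x) = (c * u k x)%C.
Proof.
  intros He Hm Hn Ho Hu k Hk.
  assert (Hk' : BZ (- k)) by (unfold BZ in *; lra).
  destruct (Hn k Hk) as [f [_ Hf]].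
  destruct (Hu k Hk) as [Hs [x0 Hx0]].
  destruct (Hf _ Hs) as [c1 Hc1].
  destruct (Hf (fun x => u (- k) (1 - x))) as [c2 Hc2].
  { destruct (Hu _ Hk') as [[Hs1 Hs2] _]; rewrite (Ho k Hk) in Hs1; split.
    - apply eigen_eq_reflect; [|exact Hs1].
      intros x; apply (layered_mirror eps1 eps2 eps He Hm).
    - now apply quasiperiodic_reflect. }
  assert (c1 <> RtoC 0).
  { intros E; apply Hx0; rewrite Hc1, E; ring. }
  exists (c2 / c1)%C; intros x; rewrite Hc2, Hc1; field; assumption.
Qed.

Theorem theorem4p3
  (mu0 : R) (Hmu0 : 0 < mu0)
  (eps1 eps2 : R -> R) (eps : R -> R -> R)
  (Heps : layered_permittivity eps1 eps2 eps)
  (omega : nat -> R -> R) (u : nat -> R -> R -> C) (n : nat)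
  (Heven : forall k, BZ k -> omega n (- k) = omega n k)
  (Hmode : forall k, BZ k -> bloch_mode mu0 eps (omega n k) k (u n k))
  (Hnorm : forall k, BZ k -> norm_cell mu0 (u n k) = 1)
  (Hsmooth : smooth_in_kappa (u n))
  (Hper : forall x, u n (- PI) x = u n PI x)
  (Hmirror : mirror_symmetric eps)
  (Hnondeg : nondegenerate mu0 eps (omega n)) :
  eq_mod_2pi (zak_phase mu0 (u n)) 0 \/ eq_mod_2pi (zak_phase mu0 (u n)) PI.
Proof.
  destruct Hsmooth as (v & Hv0 & Hvd & Hvc).
  assert (HP := PI_RGT_0).
  set (V0 := clamp_extend (v 0%nat)). set (V1 := clamp_extend (v 1%nat)).
  assert (J0 : jointly_continuous V0) by apply clamp_extend_continuous, Hvc.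
  assert (J1 : jointly_continuous V1) by apply clamp_extend_continuous, Hvc.
  assert (E0 : forall k x, BZ k -> 0 <= x <= 1 -> V0 k x = u n k x).
  { intros k x Hk Hx; unfold V0; rewrite clamp_extend_id by assumption; now apply Hv0. }
  assert (Hloc : forall k, - PI < k < PI -> locally k (fun t => - PI < t < PI)).
  { intros k Hk; apply (open_and _ _ (open_gt (- PI)) (open_lt PI)); exact Hk. }
  assert (D : forall k x, - PI < k < PI -> 0 <= x <= 1 ->
     is_derive (fun t => Re (V0 t x)) k (Re (V1 k x)) /\
     is_derive (fun t => Im (V0 t x)) k (Im (V1 k x))).
  { intros k x Hk Hx.
    unfold V1; rewrite clamp_extend_id by (unfold BZ; lra).
    destruct (is_derive_Re_Im _ _ _ (Hvd 0%nat k x Hk Hx)) as [D1 D2].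
    split; [apply (is_derive_ext_loc (fun t => Re (v 0%nat t x)))
           |apply (is_derive_ext_loc (fun t => Im (v 0%nat t x)))]; try assumption;
      apply filter_imp with (2 := Hloc k Hk); intros t Ht; unfold V0;
      rewrite clamp_extend_id; unfold BZ; auto; lra. }
  (* Only for interior k: the two-sided derivative in dkappa sees u n outside BZ
     when k = PI or - PI, but these two points do not affect the integral. *)
  assert (Dk : forall k x, - PI < k < PI -> 0 <= x <= 1 -> dkappa (u n) k x = V1 k x).
  { intros k x Hk Hx; destruct (D k x Hk Hx) as [D1 D2].
    apply injective_projections; unfold dkappa; simpl; apply is_derive_unique;
      [apply (is_derive_ext_loc (fun t => Re (V0 t x)))
      |apply (is_derive_ext_loc (fun t => Im (V0 t x)))]; try assumption;
      apply filter_imp with (2 := Hloc k Hk); intros t Ht; rewrite E0;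
      unfold BZ; auto; lra. }
  assert (N : forall k, BZ k -> inner mu0 (V0 k) (V0 k) = RtoC 1).
  { intros k Hk; apply inner_self_unit; [now apply jointly_continuous_slice|].
    rewrite <- (Hnorm k Hk); unfold norm_cell; do 2 f_equal.
    apply inner_ext; intros x Hx; apply E0; auto; lra. }
  destruct (berry_phase_multiple_PI mu0 V0 V1 J0 J1 D N) as [m Hm].
  - intros k Hk.
    destruct (mirror_mode mu0 eps1 eps2 eps (omega n) (u n)
      Heps Hmirror Hnondeg Heven Hmode k Hk) as [c Hc].
    exists c; intros x Hx; rewrite !E0; try apply Hc; unfold BZ in *; auto; lra.
  - intros x Hx; rewrite !E0; [apply Hper|..]; unfold BZ; auto; lra.
  - assert (HZ : zak_phase mu0 (u n) = RtoC (IZR m * PI)).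
    { rewrite <- Hm; unfold zak_phase; apply (RInt_ext (V := C_R_CompleteNormedModule)).
      rewrite Rmin_left, Rmax_right by lra.
      intros k Hk; unfold berry_connection; f_equal.
      apply inner_ext; intros x Hx; [apply Dk | symmetry; apply E0]; unfold BZ; auto; lra. }
    rewrite HZ.
    (* An even multiple of PI is 0, and an odd one PI, modulo 2 PI. *)
    destruct (Z.Even_or_Odd m) as [[q Hq]|[q Hq]]; [left|right]; exists q; f_equal;
      rewrite Hq, ?plus_IZR, mult_IZR; ring.
Qed.
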